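(* For every $n \geq 1$, let $$\mathrm{lcce}(n) = \min \{ \mathrm{cce}(x) : x \text{ is a factor of } \mathbf{t},\ |x| = n \},$$ where $\mathbf{t}$ is the Thue-Morse word and $\mathrm{cce}$ is the circular critical exponent. Then for all $n\geq 1$ we have $$\mathrm{lcce}(n) \in \left\{ 1, 2, \tfrac{7}{3}, \tfrac{17}{7}, \tfrac{5}{2} \right\}.$$
   Context: The Thue-Morse word $\mathbf{t} = t_0 t_1 t_2 \cdots = 01101001\cdots$ is the infinite fixed point, starting with $0$, of the morphism $\mu$ with $\mu(0)=01$, $\mu(1)=10$. A nonempty finite word $w$ (indexed from $0$) has period $p$, where $1 \le p \le |w|$, if $w[i]=w[i+p]$ for all $i$ with $0 \le i < |w|-p$. The smallest period of $w$ is denoted $p(w)$, and the exponent of $w$ is $\exp(w) = |w|/p(w)$. A factor of a word is a contiguous block inside it. The conjugates of a finite word $w$ are its cyclic shifts, i.e. the words $yx$ with $w = xy$ ($x,y$ possibly empty). The circular critical exponent $\mathrm{cce}(w)$ of a nonempty finite word $w$ is the supremum (maximum) of $\exp(x)$ over all nonempty factors $x$ of all conjugates of $w$. *)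

(* Defs.v *)
From mathcomp Require Import all_boot all_order all_algebra.
From mathcomp Require Import boolp.

Set Implicit Arguments.
Unset Strict Implicit.
Unset Printing Implicit Defensive.

Import Order.TTheory GRing.Theory Num.Theory.

(* Words over the alphabet {0, 1}, with 0 = false and 1 = true. *)
Definition word := seq bool.

Definition mu (a : bool) : word := if a then [:: true; false] else [:: false; true].
Definition mu_word (w : word) : word := flatten [seq mu a | a <- w].

(* The words mu^k(0) have length 2 ^ k and are prefixes of one another, so the
   letter at position n of the fixed point can be read off mu^n(0); see
   [thue_morse_fixed] below. *)
Definition thue_morse (n : nat) : bool :=
  nth false (iter n mu_word [:: false]) n.

Definition is_tm_factor (x : word) : Prop :=
  exists i, x = mkseq (fun k => thue_morse (i + k)) (size x).

Definition has_period (w : word) (p : nat) : bool :=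
  (0 < p <= size w) &&
  [forall i : 'I_(size w - p), nth false w i == nth false w (i + p)].

(* [ord_max] stands for the period [size w], which every nonempty word has. *)
Definition min_period (w : word) : nat :=
  [arg min_(p < (ord_max : 'I_(size w).+1) | has_period w p) (p : nat)].

Definition exponent (w : word) : rat := ((size w)%:R / (min_period w)%:R)%R.

Definition conjugates (w : word) : seq word :=
  [seq drop k w ++ take k w | k <- iota 0 (size w).+1].

Definition nonempty_factors (w : word) : seq word :=
  [seq x <- [seq take l (drop i w) | i <- iota 0 (size w), l <- iota 0 (size w).+1]
     | x != [::]].

(* All exponents are positive, so the default value 0 of the maximum is harmless
   when w is nonempty; see [cceP]. *)
Definition cce (w : word) : rat :=
  \big[Num.max/(0%R : rat)]_(y <- conjugates w)
    \big[Num.max/(0%R : rat)]_(x <- nonempty_factors y) exponent x.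

Definition tm_prefix (n : nat) : n.-tuple bool := [tuple thue_morse i | i < n].

(* The prefix of length n is a factor of length n, so the minimum is over a
   nonempty set; see [lcceP]. *)
Definition lcce (n : nat) : rat :=
  cce [arg min_(x < tm_prefix n | `[< is_tm_factor x >]) cce x]%O.

Lemma mu_word_cat u v : mu_word (u ++ v) = mu_word u ++ mu_word v.
Proof. by rewrite /mu_word map_cat flatten_cat. Qed.

Lemma size_mu_word w : size (mu_word w) = (size w).*2.
Proof. by elim: w => //= a w IH; rewrite size_cat IH; case: a. Qed.

Lemma size_iter_mu k : size (iter k mu_word [:: false]) = 2 ^ k.
Proof. by elim: k => //= k IH; rewrite size_mu_word IH expnS mul2n. Qed.

Lemma iter_mu_prefix k :
  exists s, iter k.+1 mu_word [:: false] = iter k mu_word [:: false] ++ s.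
Proof.
elim: k => [|k [s IH]]; first by exists [:: true].
by exists (mu_word s); rewrite iterS {1}IH mu_word_cat.
Qed.

Lemma nth_iter_mu k n : n < 2 ^ k ->
  nth false (iter k mu_word [:: false]) n = thue_morse n.
Proof.
have step m j d : j < 2 ^ m -> nth false (iter (m + d) mu_word [:: false]) j
                            = nth false (iter m mu_word [:: false]) j.
  move=> ltj; elim: d => [|d IH]; first by rewrite addn0.
  rewrite addnS; have [s ->] := iter_mu_prefix (m + d).
  by rewrite nth_cat size_iter_mu (leq_trans ltj) ?leq_exp2l ?leq_addr.
move=> ltn; rewrite /thue_morse.
by case: (leqP k n) => [le|/ltnW le]; rewrite -(subnKC le) step // ?subnKC // ltn_expl.
Qed.

Lemma nth_mu_word w n : n < size w ->
  (nth false (mu_word w) n.*2 = nth false w n) /\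
  (nth false (mu_word w) n.*2.+1 = ~~ nth false w n).
Proof.
elim: w n => // a w IH [_|n ltn]; first by case: a.
have [e1 e2] := IH n ltn.
by case: a {ltn}; split.
Qed.

Lemma thue_morse_fixed :
  thue_morse 0 = false /\
  forall n, [:: thue_morse n.*2; thue_morse n.*2.+1] = mu (thue_morse n).
Proof.
split=> // n; have lt1 : n < 2 ^ n by rewrite ltn_expl.
have lt2 : n.*2.+1 < 2 ^ n.+1 by rewrite expnS mul2n -doubleS leq_double.
have [] := @nth_mu_word (iter n mu_word [:: false]) n; rewrite ?size_iter_mu //.
rewrite -!iterS !nth_iter_mu // ?(ltnW lt2) // => -> ->.
by case: (thue_morse n).
Qed.

Lemma has_periodP w p :
  reflect (0 < p <= size w /\
           forall i, i < size w - p -> nth false w i = nth false w (i + p))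
          (has_period w p).
Proof.
apply: (iffP andP) => -[-> H]; split=> //.
  by move=> i lti; apply/eqP; have /forallP/(_ (Ordinal lti)) := H.
by apply/forallP=> i; apply/eqP/H.
Qed.

Lemma min_periodP w : w != [::] ->
  has_period w (min_period w) /\
  forall p, has_period w p -> min_period w <= p.
Proof.
move=> w0; rewrite /min_period; case: arg_minnP => [|p Hp minp].
  apply/has_periodP; split; last by move=> i; rewrite subnn.
  by rewrite leqnn andbT lt0n size_eq0.
split=> // q Hq; have /has_periodP[/andP[_ leq] _] := Hq.
exact: (minp (Ordinal (leq : q < (size w).+1))).
Qed.

Lemma conjugatesP w y :
  reflect (exists u v, w = u ++ v /\ y = v ++ u) (y \in conjugates w).
Proof.
apply: (iffP mapP) => [[k _ ->]|[u [v [-> ->]]]].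
  by exists (take k w), (drop k w); rewrite cat_take_drop.
exists (size u); last by rewrite drop_size_cat ?take_size_cat.
by rewrite mem_iota /= add0n ltnS size_cat leq_addr.
Qed.

Lemma mem_nonempty_factors w x :
  (x \in nonempty_factors w) = (x != [::]) && infix x w.
Proof.
rewrite mem_filter; have [->//|x0] := eqVneq x [::]; rewrite ?andTb.
apply/allpairsP/infixP => [[[i l] /= [_ _ ->]]|[s [s' ->]]].
  exists (take i w), (drop l (drop i w)).
  by rewrite !cat_take_drop.
have xgt0 : 0 < size x by rewrite lt0n size_eq0.
exists (size s, size x); split; last by rewrite /= drop_size_cat ?take_size_cat.
- by rewrite mem_iota add0n !size_cat /= -[X in X < _]addn0 ltn_add2l ltn_addr.
- by rewrite mem_iota add0n ltnS !size_cat /= addnCA leq_addr.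
Qed.

Lemma exponent_gt0 w : w != [::] -> (0 < exponent w)%R.
Proof.
move=> w0; have [/has_periodP[/andP[p0 _] _] _] := min_periodP w0.
by rewrite divr_gt0 ?ltr0n // lt0n size_eq0.
Qed.

Definition conj_factor (w x : word) : Prop :=
  x != [::] /\ exists2 y, y \in conjugates w & infix x y.

Lemma cceP w : w != [::] ->
  (exists2 x, conj_factor w x & exponent x = cce w) /\
  (forall x, conj_factor w x -> (exponent x <= cce w)%R).
Proof.
move=> w0.
have ub x : conj_factor w x -> (exponent x <= cce w)%R.
  case=> x0 [y yw xy]; rewrite /cce; apply: (@bigmax_sup_seq _ _ _ _ _ y) => //.
  by apply: (@bigmax_sup_seq _ _ _ _ _ x) => //; rewrite mem_nonempty_factors x0.
split=> //.
have ww : conj_factor w w.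
  split=> //; exists w; last exact: infix_refl.
  by apply/conjugatesP; exists [::], w; rewrite cats0.
have /(lt_le_trans (exponent_gt0 w0)) := ub _ ww.
suff: (cce w = 0)%R \/ exists2 x, conj_factor w x & exponent x = cce w.
  by case=> // ->; rewrite ltxx.
pose K (v : rat) := v = 0%R \/ exists2 x, conj_factor w x & exponent x = v.
have K0 : K 0%R by left.
have Kmax u v : K u -> K v -> K (Num.max u v).
  by move=> Ku Kv; rewrite /Order.max; case: ifP.
rewrite -/(K (cce w)) /cce big_seq; apply: (big_ind K) => // y yw.
rewrite big_seq; apply: (big_ind K) => // x.
rewrite mem_nonempty_factors => /andP[x0 xy]; right; exists x => //.
by split=> //; exists y.
Qed.

Lemma lcceP n :
  (exists x, [/\ is_tm_factor x, size x = n & cce x = lcce n]) /\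
  (forall x, is_tm_factor x -> size x = n -> (lcce n <= cce x)%R).
Proof.
rewrite /lcce; case: arg_minP => [|x /asboolP xP xmin].
  apply/asboolP; exists 0; rewrite size_tuple.
  apply: (@eq_from_nth _ false); rewrite size_tuple ?size_mkseq // => i lti.
  rewrite nth_mkseq // add0n -[i]/(nat_of_ord (Ordinal lti)).
  by rewrite -tnth_nth tnth_mktuple.
split; first by exists x; rewrite size_tuple.
move=> y yP /eqP sy; exact: (xmin (Tuple sy) (introT (asboolP _) yP)).
Qed.

(* Main.v *)
(* A circular run of [w] is a factor of length [L <= |w|] with period [p] of a
   conjugate of [w]; [cce w] is the largest ratio [L / p].

   If [w] is a factor of the Thue-Morse word of even length whose circular word
   is, up to rotation, [mu v] with [v] again a factor, then [cce w = cce v]: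
   runs of even period halve, and runs of odd period have exponent at most 2.
   Otherwise the two sides of the seam (where the end of [w] meets its start)
   disagree on the parity of the block decomposition, or share it but put an
   undecomposable block [aa] across the seam.  Since a common factor of length 4
   determines the parity, a run of exponent above 7/3 across such a seam has
   period at most 17 and stays within 20 letters of the seam.  A finite check on
   pairs of windows of length 20 then gives [cce w = 7/3], [17/7], [5/2] or
   [cce w > 5/2].

   Every length also has a factor with [cce <= 5/2].  The same halving reduces
   this to odd lengths, for which the first and last 20 letters are placed inside
   blocks [mu^6(a)] and [mu^6(b)]; the letters [a], [b] are free because every
   pair of letters occurs at every positive distance.  Short lengths are computed
   directly. *)

Require Import Defs.
From mathcomp Require Import all_boot all_order all_algebra.
From mathcomp Require Import boolp zify.

Set Implicit Arguments.
Unset Strict Implicit.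
Unset Printing Implicit Defensive.

Import Order.TTheory GRing.Theory Num.Theory.

(** * Parity and repetitions in the Thue-Morse word *)

Definition periodic_on (c : nat -> bool) (s L p : nat) : Prop :=
  forall k, k + p < L -> c (s + k) = c (s + k + p).

Lemma tm_double k : thue_morse k.*2 = thue_morse k.
Proof. by have [_ /(_ k)] := thue_morse_fixed; case: (thue_morse k) => -[-> _]. Qed.

Lemma tm_doubleS k : thue_morse k.*2.+1 = ~~ thue_morse k.
Proof. by have [_ /(_ k)] := thue_morse_fixed; case: (thue_morse k) => -[_ ->]. Qed.

Lemma tm_even k : ~~ odd k -> thue_morse k.+1 = ~~ thue_morse k.
Proof. by move=> ek; rewrite -(even_halfK ek) tm_doubleS tm_double. Qed.

(** The [q]-th block of length 2^m is mu^m(t_q), that is, mu^m(0) or its complement. *)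
Lemma tm_pow2_block m q j : j < 2 ^ m ->
  thue_morse (2 ^ m * q + j) = thue_morse q (+) thue_morse j.
Proof.
elim: m j => [|m IH] j; first by case: j => // _; rewrite mul1n addn0 addbF.
rewrite expnS => ltj; have ltj' : j./2 < 2 ^ m by lia.
rewrite -(odd_double_half j); case: (odd j) => /=.
  have -> : 2 * 2 ^ m * q + (1 + j./2.*2) = (2 ^ m * q + j./2).*2.+1 by lia.
  by rewrite add1n !tm_doubleS IH // addbN.
have -> : 2 * 2 ^ m * q + (0 + j./2.*2) = (2 ^ m * q + j./2).*2 by lia.
by rewrite add0n !tm_double IH.
Qed.

Lemma alternating_parity (c : nat -> bool) s m :
  (forall k, k < m -> c (s + k).+1 = ~~ c (s + k)) ->
  forall k, k <= m -> c (s + k) = odd k (+) c s.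
Proof.
move=> alt; elim=> [|k IH] ltk; first by rewrite addn0.
by rewrite addnS alt // IH 1?ltnW //= addNb.
Qed.

(* Two adjacent equalities at odd distance meet one aligned block, so the word
   alternates along the whole run, which an odd period forbids. *)
Lemma odd_period_bound (c : nat -> bool) s L p :
  (forall k, ~~ odd k -> c k.+1 = ~~ c k) ->
  odd p -> periodic_on c s L p -> L <= p.*2.
Proof.
move=> al op per; rewrite leqNgt; apply/negP => ltL.
have alt k : k < p -> c (s + k).+1 = ~~ c (s + k).
  move=> ltk; case: (boolP (odd (s + k))) => [o|/al//].
  have e1 := per k; have e2 := per k.+1; rewrite addnS in e2.
  rewrite e1 ?e2; try lia.
  by rewrite addSn al // oddD o op.
have := alternating_parity alt (leqnn p).
have := per 0; rewrite !addn0 op => -> //; last by lia.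
by case: (c _).
Qed.

Lemma tm_overlap_free s L p :
  0 < p -> periodic_on thue_morse s L p -> L <= p.*2.
Proof.
elim/ltn_ind: p s L => p IH s L p0 per.
case: (boolP (odd p)) => [op|ep].
  by apply: odd_period_bound op per => k; apply: tm_even.
rewrite leqNgt; apply/negP => ltL.
(* Every second letter of an overlap of even period gives, up to complement, an overlap of half the
   period. *)
suff : p./2.*2.+1 <= p./2.*2 by lia.
apply: (IH p./2 _ s./2); [lia|lia|] => k ltk.
have := per k.*2.
have [-> ->] : s + k.*2 = odd s + (s./2 + k).*2 /\
   s + k.*2 + p = odd s + (s./2 + k + p./2).*2 by split; lia.
case: (odd s); rewrite ?add1n ?add0n ?tm_doubleS ?tm_double => H.
  by apply: negb_inj; apply: H; lia.
by apply: H; lia.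
Qed.

(** Under an odd shift each adjacent pair is an aligned block in one of the two copies, so the
    common factor alternates. Four alternating letters from an odd position come from three equal
    letters, two of which form a block. *)
Lemma tm_odd_shift i j m : odd (i + j) ->
  (forall k, k < m -> thue_morse (i + k) = thue_morse (j + k)) -> m <= 3.
Proof.
wlog oi : i j / odd i => [W|] oij eq.
  case: (boolP (odd i)) => oi; first exact: (W i j).
  apply: (W j i) => [||k ltk]; [by lia|by rewrite addnC|by rewrite eq].
rewrite leqNgt; apply/negP => ltm.
have alt k : k < 3 -> thue_morse (i + k).+1 = ~~ thue_morse (i + k).
  move=> ltk; case: (boolP (odd (i + k))) => [o|/tm_even//].
  have := eq k.+1; have := eq k; rewrite !addnS => -> // => [->|]; try lia.
  by rewrite tm_even //; lia.
move: (alt 0 isT) (alt 1 isT) (alt 2 isT).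
have -> : i + 0 = i./2.*2.+1 by lia.
have -> : i + 1 = i./2.+1.*2 by lia.
have -> : i + 2 = i./2.+1.*2.+1 by lia.
rewrite -!doubleS !tm_doubleS !tm_double !negbK => e1 _ e2.
case: (boolP (odd i./2)) => o; last by move: e1; rewrite tm_even //; case: thue_morse.
by move: e2; rewrite tm_even /= ?o //; case: thue_morse.
Qed.

Lemma tm_letter_pair q a b : 0 < q ->
  exists i, thue_morse i = a /\ thue_morse (i + q) = b.
Proof.
have nconst d : 0 < q -> ~ forall i, thue_morse (i + q) = d (+) thue_morse i.
  elim/ltn_ind: q => q IH q0 eq.
  case: (boolP (odd q)) => [oq|eq2].
    have alt m : q <= m -> thue_morse m.+1 = ~~ thue_morse m.
      move=> leqm; case: (boolP (odd m)) => [om|/tm_even//].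
      have := eq (m - q).+1; rewrite addSn subnK // => ->.
      have := eq (m - q); rewrite subnK // => ->.
      by rewrite tm_even ?addbN //; lia.
    (* An alternating word of length 5 is an overlap of period 2. *)
    have // := @tm_overlap_free q 5 2 isT.
    suff per : periodic_on thue_morse q 5 2 by move=> /(_ per).
    by move=> k _; rewrite addn2 !alt ?negbK //; lia.
  apply: (IH q./2); [lia|lia|] => i.
  by have := eq i.*2; rewrite -(even_halfK eq2) -doubleD !tm_double half_double.
move=> q0; have [i eqi] : exists i, thue_morse (i + q) = b (+) a (+) thue_morse i.
  apply: contrapT => /forallNP H; apply: (nconst (~~ (b (+) a)) q0) => i.
  by have := H i; rewrite addNb; case: (_ (+) _) (thue_morse _) => [] [].
case: (eqVneq (thue_morse i) a) => [ai|ai]; first by exists i; rewrite eqi ai addbK.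
have lt : i + q < 2 ^ (i + q) by rewrite ltn_expl.
(* Adding a power of two above [i + q] complements both letters. *)
exists (2 ^ (i + q) * 1 + i); rewrite -addnA !tm_pow2_block //; last by lia.
by rewrite eqi; split; case: (thue_morse i) a b ai {eqi} => [] [] [].
Qed.

(** * Circular runs as a description of [cce] *)

Definition cyc (w : word) (k : nat) : bool := nth false w (k %% size w).

Lemma cycDsize w k : cyc w (k + size w) = cyc w k.
Proof. by rewrite /cyc modnDr. Qed.

Definition circular_run (w : word) (s L p : nat) : Prop :=
  [/\ 0 < p <= L, L <= size w & periodic_on (cyc w) s L p].

Lemma ler_ratio (a b L p : nat) : 0 < b -> 0 < p ->
  (a%:R / b%:R <= L%:R / p%:R :> rat)%R = (a * p <= L * b).
Proof.
move=> b0 p0; rewrite ler_pdivrMr ?ltr0n // mulrAC ler_pdivlMr ?ltr0n //.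
by rewrite -!natrM ler_nat.
Qed.

(** The rotation by [s] starts with the run, and the minimal period of that prefix is at most
    [p]. *)
Lemma circular_run_le_cce w s L p :
  circular_run w s L p -> (L%:R / p%:R <= cce w)%R.
Proof.
case=> /andP[p0 leL] leLn per.
have w0 : 0 < size w by lia.
have wn0 : w != [::] by rewrite -size_eq0 -lt0n.
pose r := s %% size w; have ltr : r < size w by rewrite ltn_mod.
pose x := mkseq (fun k => cyc w (s + k)) L.
have sx : size x = L by rewrite size_mkseq.
have x0 : x != [::] by rewrite -size_eq0 sx -lt0n; lia.
have Hx : conj_factor w x.
  split=> //; exists (drop r w ++ take r w).
    by apply/conjugatesP; exists (take r w), (drop r w); rewrite cat_take_drop.
  apply/infixP; exists [::], (drop L (drop r w ++ take r w)).
  rewrite /= -[LHS](cat_take_drop L); congr (_ ++ _).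
  have sd : size (drop r w ++ take r w) = size w.
    by rewrite size_cat size_drop size_takel; lia.
  apply: (@eq_from_nth _ false); rewrite size_takel ?sd ?sx // => k ltk.
  rewrite nth_take // nth_mkseq // nth_cat size_drop /cyc -modnDml -/r.
  case: ltnP => H; first by rewrite nth_drop modn_small //; lia.
  rewrite nth_take; last by lia.
  congr nth; rewrite -[in RHS](subnK (_ : size w <= r + k)); last by lia.
  by rewrite modnDr modn_small; lia.
have [_ /(_ x Hx)] := cceP wn0; apply: le_trans.
have [/has_periodP[/andP[mp0 _] _] minx] := min_periodP x0.
rewrite /exponent sx ler_ratio // leq_mul2l; apply/orP; right; apply: minx.
apply/has_periodP; rewrite sx p0 leL; split=> // k ltk.
by rewrite !nth_mkseq ?addnA ?per //; lia.
Qed.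

(** The maximising factor with its minimal period is a run, so the bound of [circular_run_le_cce] is
    attained. *)
Lemma circular_run_cce (w : word) : w != [::] ->
  exists s L p, [/\ s < size w, circular_run w s L p & (L%:R / p%:R = cce w)%R].
Proof.
move=> wn0; have [x [y [u [v [a [b [x0 Ew Ey Eab <-]]]]]]] :
    exists x y u v a b : word, [/\ x != [::], w = u ++ v, y = v ++ u,
      y = a ++ x ++ b & exponent x = cce w].
  have [[x [x0 [y /conjugatesP[u [v [Ew Ey]]] /infixP[a [b Eab]]]] Ex] _] := cceP wn0.
  by exists x, y, u, v, a, b.
have w0 : 0 < size w by case: (w) wn0.
have [/has_periodP[pb per] _] := min_periodP x0.
have sy : size y = size w by rewrite Ew Ey !size_cat addnC.
exists ((size u + size a) %% size w), (size x), (min_period x).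
rewrite ltn_mod; split=> //; split=> //.
  by rewrite -sy Eab !size_cat addnCA leq_addr.
have E k : k < size x -> cyc w ((size u + size a) %% size w + k) = nth false x k.
  move=> ltk; rewrite /cyc modnDml.
  have -> : nth false x k = nth false y (size a + k).
    rewrite Eab nth_cat ifF; last by lia.
    by rewrite addKn nth_cat ltk.
  have lty : size a + k < size w by rewrite -sy Eab !size_cat; lia.
  rewrite Ey nth_cat -addnA; case: ltnP => H.
    rewrite modn_small; last by rewrite Ew size_cat; lia.
    by rewrite Ew nth_cat ifF ?addKn //; lia.
  have -> : size u + (size a + k) = size a + k - size v + size w.
    by rewrite Ew size_cat; lia.
  rewrite modnDr modn_small; last by lia.
  by rewrite Ew nth_cat ifT //; move: lty; rewrite Ew size_cat; lia.
move=> k ltk; rewrite -addnA !E; try lia.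
by apply: per; lia.
Qed.

(** Among four consecutive binary letters two neighbours agree, or the four form abab. *)
Lemma cce_ge2 w : 4 <= size w -> (2 <= cce w)%R.
Proof.
move=> w4; have sq (k : nat) : cyc w k = cyc w k.+1 -> (2 <= cce w)%R.
  move=> e; rewrite -[2%R](divr1 2%R); apply: (@circular_run_le_cce w k 2 1).
  split=> //; first by lia.
  by case=> [_|j]; [rewrite addn0 addn1 | lia].
case: (eqVneq (cyc w 0) (cyc w 1)) => [/sq//|n0].
case: (eqVneq (cyc w 1) (cyc w 2)) => [/sq//|n1].
case: (eqVneq (cyc w 2) (cyc w 3)) => [/sq//|n2].
have <- : (4%:R / 2%:R = 2 :> rat)%R by [].
apply: (@circular_run_le_cce w 0); split=> // k.
case: k => [_|[_|k]]; last by lia.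
  by move: n0 n1; case: (cyc w 0) (cyc w 1) (cyc w 2) => [] [] [].
by move: n1 n2; case: (cyc w 1) (cyc w 2) (cyc w 3) => [] [] [].
Qed.

(** * Halving a circular word whose rotation by [d] is [mu_word v] *)

Section Doubling.
Variables (w v : word) (d : nat).
Hypothesis sw : size w = (size v).*2.
Hypothesis led : d <= size w.
Hypothesis cyc_even : forall k, cyc w (d + k.*2) = cyc v k.
Hypothesis cyc_odd : forall k, cyc w (d + k.*2.+1) = ~~ cyc v k.

Lemma cce_double_ge : v != [::] -> (cce v <= cce w)%R.
Proof.
move=> v0; have [s [L [p [_ [pb leL per] <-]]]] := circular_run_cce v0.
have -> : (L%:R / p%:R = L.*2%:R / p.*2%:R :> rat)%R.
  apply/eqP; rewrite eq_le !ler_ratio; [|lia..].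
  by apply/andP; split; lia.
apply: (@circular_run_le_cce w (d + s.*2)); split; [lia|lia|] => k ltk.
have [-> ->] : d + s.*2 + k = d + (odd k + (s + k./2).*2) /\
  d + s.*2 + k + p.*2 = d + (odd k + (s + k./2 + p).*2) by split; lia.
have := per k./2; case: (odd k) => H.
  by rewrite !add1n !cyc_odd H //; lia.
by rewrite !add0n !cyc_even H //; lia.
Qed.

Lemma cce_double_le : v != [::] -> (cce w <= Num.max 2 (cce v))%R.
Proof.
move=> v0; have sv0 : 0 < size v by rewrite lt0n size_eq0.
have w0 : w != [::] by rewrite -size_eq0 sw; lia.
have [s [L [p [_ [pb leL per] <-]]]] := circular_run_cce w0.
(* Start of the run relative to the rotation; adding [size w] prevents truncated subtraction. *)
rewrite le_max; pose s' := s + size w - d.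
have per' : periodic_on (fun k => cyc w (d + k)) s' L p.
  move=> k ltk; have -> : d + (s' + k) = s + k + size w by rewrite /s'; lia.
  have -> : d + (s' + k + p) = s + k + p + size w by rewrite /s'; lia.
  by rewrite !cycDsize per.
case: (boolP (odd p)) => op.
  apply/orP; left; have <- : (2%:R / 1%:R = 2 :> rat)%R by [].
  rewrite ler_ratio //; last by lia.
  have : L <= p.*2; last by lia.
  apply: odd_period_bound op per' => k ek.
  by rewrite -(even_halfK ek) cyc_odd cyc_even.
(* Every second letter of the run, from its first on, gives a run of [v] of length ceil(L/2) and
   period p/2. *)
apply/orP; right; apply: (@le_trans _ _ ((uphalf L)%:R / (p./2)%:R)%R).
  by rewrite ler_ratio; [nia|lia|lia].
apply: (@circular_run_le_cce v s'./2); split; [lia|lia|] => k ltk.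
have := per' k.*2.
have [-> ->] : s' + k.*2 = odd s' + (s'./2 + k).*2 /\
   s' + k.*2 + p = odd s' + (s'./2 + k + p./2).*2 by split; lia.
case: (odd s'); rewrite ?add1n ?add0n ?cyc_odd ?cyc_even => H.
  by apply: negb_inj; apply: H; lia.
by apply: H; lia.
Qed.

End Doubling.

(** * Factors of the Thue-Morse word and their seams *)

Definition tm_factor (i n : nat) : word := mkseq (fun k => thue_morse (i + k)) n.

Lemma cyc_tm_factor i n k : 0 < n -> cyc (tm_factor i n) k = thue_morse (i + k %% n).
Proof. by move=> n0; rewrite /cyc size_mkseq nth_mkseq // ltn_mod. Qed.

(** Admitting values above 5/2 makes this hold for every nonempty factor; for the minimum
    [exists_low_cce] excludes them. *)
Definition good_value (x : rat) : bool :=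
  (x \in [:: 1; 2; 7 / 3; 17 / 7; 5 / 2]%R) || (5 / 2 < x)%R.

(* In the even case the first and last letters of the factor, which are equal
   halves of two truncated blocks, meet at the seam as a non-block [aa]. *)
Definition misaligned (i n : nat) : bool :=
  odd n || odd i && (thue_morse i == thue_morse (i + n.-1)).

(** An aligned seam continues the block decomposition, so [cce_double_ge] and [cce_double_le] apply.
    From [n] = 8 on the half has at least 4 letters, and [cce_ge2] removes the maximum with 2. *)
Lemma cce_aligned i n : 8 <= n -> ~~ misaligned i n ->
  cce (tm_factor i n) = cce (tm_factor i./2 n./2).
Proof.
move=> n8; rewrite /misaligned negb_or negb_and => /andP[en al].
have n2 : 0 < n./2 by lia.
have [d [led ev od]] : exists d, [/\ d <= n,
    forall k, cyc (tm_factor i n) (d + k.*2) = cyc (tm_factor i./2 n./2) k &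
    forall k, cyc (tm_factor i n) (d + k.*2.+1) = ~~ cyc (tm_factor i./2 n./2) k].
  have E k : (k.*2 %% n = (k %% n./2).*2) /\ (k.*2.+1 %% n = (k %% n./2).*2.+1).
    have En : n = n./2.*2 by rewrite even_halfK.
    have ltm := ltn_pmod k n2.
    have -> : k.*2 = (k %/ n./2) * n + (k %% n./2).*2.
      by rewrite {1}(divn_eq k n./2) doubleD doubleMr -En.
    rewrite -addnS !modnMDl; move: (k %% n./2) ltm => r ltr.
    by split; apply: modn_small; clear -ltr En; lia.
  case: (boolP (odd i)) => oi; last first.
    exists 0; split=> // k; rewrite add0n !cyc_tm_factor ?(leq_trans _ n8) //.
      by rewrite (E k).1 -[i in LHS](even_halfK oi) -doubleD tm_double.
    by rewrite (E k).2 -[i in LHS](even_halfK oi) addnS -doubleD tm_doubleS.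
  have Ei : i = i./2.*2.+1 by rewrite -[LHS]odd_double_half oi.
  have al' : thue_morse (i + n.-1) = thue_morse i./2.*2.
    move: al; rewrite oi /= {1}Ei tm_doubleS tm_double.
    by case: (thue_morse i./2); case: thue_morse.
  (* The last letter is the one preceding the factor: rotate it to the front. *)
  have rotE k : cyc (tm_factor i n) (n.-1 + k) = thue_morse (i./2.*2 + k %% n).
    rewrite cyc_tm_factor ?(leq_trans _ n8) // -modnDmr.
    have : k %% n < n by rewrite ltn_mod (leq_trans _ n8).
    case: (k %% n) => [|r] ltr.
      by rewrite !addn0 modn_small ?al' // ltn_predL (leq_trans _ n8).
    have -> : n.-1 + r.+1 = r + n by rewrite addnS addnC -addnS prednK // (leq_trans _ n8).
    by rewrite modnDr modn_small 1?ltnW // [i in LHS]Ei addSnnS.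
  exists n.-1; split=> [|k|k]; rewrite ?leq_pred // rotE cyc_tm_factor //.
    by rewrite (E k).1 -doubleD tm_double.
  by rewrite (E k).2 addnS -doubleD tm_doubleS.
have sw : size (tm_factor i n) = (size (tm_factor i./2 n./2)).*2.
  by rewrite !size_mkseq; lia.
have v0 : tm_factor i./2 n./2 != [::] by rewrite -size_eq0 size_mkseq; lia.
have led' : d <= size (tm_factor i n) by rewrite size_mkseq.
have := cce_double_le sw led' ev od v0.
rewrite (max_idPr _); last by apply: cce_ge2; rewrite size_mkseq; lia.
by move=> le; apply/eqP; rewrite eq_le le (cce_double_ge sw led' ev od).
Qed.

(** Such a run crosses the seam, as the factor itself is overlap-free. The parities of [p] and [n]
    then decide which comparisons at distance [p] limit it. *)
Lemma seam_run_local i n s L p : misaligned i n -> s < n ->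
  circular_run (tm_factor i n) s L p -> 7 * p < 3 * L ->
  [/\ p <= 17, n <= s + 20 & s + L <= n + 20].
Proof.
move=> mis ltsn [/andP[p0 leL]]; rewrite size_mkseq => leLn per lt7.
have n0 : 0 < n by lia.
pose f k := if k < n then thue_morse (i + k) else thue_morse (i + (k - n)).
have {}per k : k + p < L -> f (s + k) = f (s + k + p).
  move=> ltk; have := per k ltk; rewrite !cyc_tm_factor // /f.
  have E j : j < n + n -> j %% n = if j < n then j else j - n.
    move=> ltj; case: ltnP => lej; first by rewrite modn_small.
    by rewrite -{1}(subnK lej) modnDr modn_small //; lia.
  by rewrite !E; try lia; do 2!case: ifP.
have fl k : k < n -> f k = thue_morse (i + k) by rewrite /f => ->.
have fr k : n <= k -> f k = thue_morse (i + (k - n)).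
  by move=> lek; rewrite /f ltnNge lek.
(* Positions [p] apart lie both before the seam, both after it, or on opposite sides. *)
have LL k : s + k + p < n -> k + p < L ->
    thue_morse (i + s + k) = thue_morse (i + s + k + p).
  by move=> lt1 lt2; have := per k lt2; rewrite !fl ?addnA //; lia.
have RR k : n + k + p < s + L -> thue_morse (i + k) = thue_morse (i + k + p).
  move=> lt1; have := per (n + k - s); rewrite !fr; try lia.
  have -> : i + (s + (n + k - s) - n) = i + k by lia.
  have -> : i + (s + (n + k - s) + p - n) = i + k + p by lia.
  by apply; lia.
have LR k : s <= k < n -> n <= k + p < s + L ->
    thue_morse (i + k) = thue_morse (i + (k + p - n)).
  move=> /andP[lt1 lt2] /andP[lt3 lt4].
  by have := per (k - s); rewrite subnKC // fl // fr //; apply; lia.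
have cross : n < s + L.
  rewrite ltnNge; apply/negP => leE.
  suff : L <= p.*2 by clear -lt7; lia.
  apply: (@tm_overlap_free (i + s)) => // k ltk.
  by apply: LL; clear -leE ltk; lia.
pose a := n - s; pose b := s + L - n.
have [Ea Eb] : n = s + a /\ s + L = n + b by rewrite /a /b; clear -cross ltsn; lia.
clearbody a b.
have LLfree : a <= p.*2.
  apply: (@tm_overlap_free (i + s)) => // k ltk.
  by apply: LL; clear -Ea Eb ltk; lia.
have RRfree : b <= p.*2.
  by apply: (@tm_overlap_free i) => // k ltk; apply: RR; clear -Eb ltk; lia.
(* Odd [p]: each side has at most p + 3 letters, so 7p < 3(2p + 6) and p <= 17. *)
case: (boolP (odd p)) => op.
  have LL3 : a <= p + 3.
    rewrite -leq_subLR; apply: (@tm_odd_shift (i + s) (i + s + p)) => [|k ltk].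
      by clear -op; lia.
    by rewrite LL ?(addnAC _ p) //; clear -Ea Eb ltk; lia.
  have RR3 : b <= p + 3.
    rewrite -leq_subLR; apply: (@tm_odd_shift i (i + p)) => [|k ltk].
      by clear -op; lia.
    by rewrite RR ?(addnAC _ p) //; clear -Eb ltk; lia.
  by clear -Ea Eb LL3 RR3 lt7; split; lia.
(* Even [p], odd [n]: comparisons across the seam have odd shift, so four in a row are impossible;
   hence [p], [a] or [b] is at most 3. *)
case: (boolP (odd n)) => on.
  have LR3 k0 m : s <= k0 -> n <= k0 + p -> k0 + m <= n -> k0 + m + p <= s + L -> m <= 3.
    move=> le1 le2 le3 le4.
    apply: (@tm_odd_shift (i + k0) (i + (k0 + p - n))) => [|k ltk].
      by clear -op on le2; lia.
    rewrite -addnA LR; [|clear -le1 le3 ltk; lia|clear -le2 le4 ltk; lia].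
    by congr thue_morse; clear -le2; lia.
  have [lt3|ge4] := leqP p 3.
    by clear -lt3 LLfree RRfree Ea Eb; split; lia.
  have [a3|a4] := leqP a 3; first by clear -a3 RRfree lt7 Ea Eb; split; lia.
  have [b3|b4] := leqP b 3; first by clear -b3 LLfree lt7 Ea Eb; split; lia.
  have [le|/ltnW le] := leqP a p.
    by have := @LR3 s 4; clear -le a4 b4 ge4 Ea Eb lt7; lia.
  by have := @LR3 (n - p) 4; clear -le a4 b4 ge4 Ea Eb lt7; lia.
have [oi /eqP eqi] : odd i /\ thue_morse i == thue_morse (i + n.-1).
  by move: mis; rewrite /misaligned (negPf on) => /andP.
(* Even [p] and [n]: translation by [p] copies the equal pair at the seam onto an aligned block,
   whose letters differ. *)
exfalso; have [leb|ltb] := leqP b p.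
  pose j := n.-1 - p.
  have [lej Ej] : s <= j /\ n = (j + p).+1 by rewrite /j; clear -leb lt7 Ea Eb p0; lia.
  clearbody j.
  have e1 : thue_morse (i + j) = thue_morse i.
    rewrite eqi; have := LL (j - s); have -> : i + s + (j - s) = i + j by clear -lej; lia.
    move=> ->.
    - by congr thue_morse; clear -Ej; lia.
    - by clear -lej Ej; lia.
    - by clear -lej Ej Eb cross; lia.
  have e2 : thue_morse (i + j).+1 = thue_morse i.
    rewrite -addnS LR; last 2 first.
    - by clear -lej Ej p0; lia.
    - by clear -lej Ej Eb cross; lia.
    by congr thue_morse; clear -Ej; lia.
  have ev : ~~ odd (i + j) by clear -oi on op Ej; lia.
  by have := tm_even ev; rewrite e1 e2; case: (thue_morse i).
have e1 : thue_morse (i + p.-1) = thue_morse i.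
  rewrite eqi (LR n.-1); last 2 first.
  - by clear -ltsn; lia.
  - by clear -ltb Eb p0; lia.
  by congr thue_morse; clear -p0 n0; lia.
have e2 : thue_morse (i + p.-1).+1 = thue_morse i.
  rewrite -[in RHS](addn0 i) (RR 0); last by clear -ltb Eb; lia.
  by congr thue_morse; clear -p0; lia.
have ev : ~~ odd (i + p.-1) by clear -oi op p0; lia.
by have := tm_even ev; rewrite e1 e2; case: (thue_morse i).
Qed.

(** * Decidable search for runs *)

(* [e = 1] gives the least [L] with [a / b <= L / p], and [e = 0] the least
   [L] with [a / b < L / p]. *)
Definition min_run_length (e a b p : nat) : nat := ((a * p - e) %/ b).+1.

(* Holds iff the first [k] entries of [s] are true or [s] has [m] consecutive
   true entries somewhere, for [k <= m]. *)
Fixpoint true_block (m k : nat) (s : seq bool) : bool :=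
  if k is k'.+1 then
    if s is b :: s' then (if b then true_block m k' s' else true_block m m s')
    else false
  else true.

Definition coincidences (p : nat) (x : word) : seq bool :=
  [seq z.1 == z.2 | z <- zip x (drop p x)].

(** For each period only the least sufficient length is tried, since a longer run contains it. *)
Definition has_run (e cap P a b : nat) (x : word) : bool :=
  has (fun p => let L := min_run_length e a b p in
         (L <= cap) && true_block (L - p) (L - p) (coincidences p x))
      (iota 1 P).

(** In the left alternative a block has already begun and [k] entries are still due. *)
Lemma true_blockP m k s : k <= m ->
  true_block m k s <->
  (forall i, i < k -> nth false s i) \/
  exists j, forall i, i < m -> nth false s (j + i).
Proof.
elim: s k => [|c s IH] [|k] lekm /=; try by split=> // _; left.
  by split=> // -[/(_ 0 isT)|[j /(_ 0)]]; rewrite ?nth_nil // => /(_ (leq_ltn_trans (leq0n _) lekm)).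
have m0 := leq_ltn_trans (leq0n _) lekm.
case: c; rewrite IH ?(ltnW lekm) //; split.
- move=> [H|[j H]]; first by left; case.
  by right; exists j.+1.
- move=> [H|[[|j] H]]; first by left=> i /(H i.+1).
    by left=> i lti; apply: (H i.+1); apply: leq_trans lekm.
  by right; exists j.
- by move=> [H|[j H]]; right; [exists 1 | exists j.+1].
- move=> [/(_ 0 isT)//|[[|j] H]]; first by have := H 0 m0.
  by right; exists j.
Qed.

Lemma nth_coincidences p x i : nth false (coincidences p x) i ->
  i + p < size x /\ nth false x i = nth false x (i + p).
Proof.
case: (ltnP i (size (coincidences p x))) => [|le]; last by rewrite nth_default.
rewrite size_map size_zip size_drop => lti.
rewrite (nth_map (false, false)) ?size_zip ?size_drop // nth_zip_cond.
rewrite size_zip size_drop lti /= nth_drop addnC => /eqP ->.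
by split=> //; move: lti; rewrite leq_min ltn_subRL addnC => /andP[].
Qed.

Lemma has_run_sound e cap P a b (x w : word) off :
  e <= 1 -> (forall k, k < size x -> nth false x k = cyc w (off + k)) ->
  cap <= size w -> 0 < b <= a -> has_run e cap P a b x ->
  exists L p, [/\ 0 < p, a * p - e < L * b & (L%:R / p%:R <= cce w)%R].
Proof.
move=> e1 xw lecap /andP[b0 leba] /hasP[p]; rewrite mem_iota => /andP[p0 _].
set L := min_run_length e a b p => /andP[leLc /true_blockP].
move=> /(_ (leqnn _)) block.
have [s run] : exists s, forall i, i < L - p -> nth false (coincidences p x) (s + i).
  by case: block => // H; exists 0.
have ltL : a * p - e < L * b by rewrite -ltn_divLR.
have lepL : p <= L.
  by rewrite -(@leq_pmul2r b) //; clear -ltL leba e1 p0 b0; nia.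
exists L, p; split=> //; apply: (@circular_run_le_cce w (off + s)).
split; [by rewrite p0 | exact: leq_trans lecap|] => k ltk.
have [|ltx Ex] := @nth_coincidences p x (s + k); first by apply: run; clear -ltk; lia.
by rewrite -!addnA -!xw ?(addnA s) //; clear -ltx; lia.
Qed.

Lemma has_run_complete cap P a b (x w : word) off s L p :
  (forall k, k < size x -> nth false x k = cyc w (off + k)) ->
  0 < b -> a * p < L * b -> 0 < p <= P -> L <= cap -> s + L <= size x ->
  periodic_on (cyc w) (off + s) L p -> has_run 0 cap P a b x.
Proof.
move=> xw b0 ltab /andP[p0 leP] leLc leLx per.
have leL : min_run_length 0 a b p <= L by rewrite /min_run_length subn0 ltn_divLR.
apply/hasP; exists p; first by rewrite mem_iota p0 add1n.
apply/andP; split; first exact: leq_trans leLc.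
apply/true_blockP => //; right; exists s => k ltk.
have lt : s + k + p < size x by clear -ltk leL leLx; lia.
have szk : s + k < size (zip x (drop p x)).
  by rewrite size_zip size_drop; clear -lt; lia.
rewrite (nth_map (false, false)) // nth_zip_cond szk /= nth_drop !xw.
- by rewrite [p + _]addnC !addnA; apply/eqP/per; clear -ltk leL; lia.
- by rewrite addnC.
- by clear -lt; lia.
Qed.

(* Circular runs are only witnessed up to length [cap]; on a seam window, longer
   runs need not fit in the factor but are still ruled out up to [capx]. *)
Definition classified (cap capx P : nat) (l : seq (nat * nat)) (x : word) : bool :=
  has_run 1 cap P 5 2 x ||
  has (fun v => has_run 1 cap P v.1 v.2 x && ~~ has_run 0 capx P v.1 v.2 x) l.

(** A run found bounds [cce] from below; the absence of a longer one bounds it from above through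
    the completeness hypothesis. *)
Lemma classified_good cap capx P l (x w : word) off :
  (forall k, k < size x -> nth false x k = cyc w (off + k)) ->
  cap <= size w ->
  {subset l <= [:: (17, 7); (7, 3); (2, 1); (1, 1)]} ->
  (forall a b, (a, b) \in l -> (a%:R / b%:R < cce w)%R -> has_run 0 capx P a b x) ->
  classified cap capx P l x -> good_value (cce w).
Proof.
move=> xw lecap lsub compl.
have ge a b : 0 < b <= a -> has_run 1 cap P a b x -> (a%:R / b%:R <= cce w)%R.
  move=> /andP[b0 leba] H; have [//|//|L [p [p0 lt]]] := has_run_sound _ xw lecap _ H.
    by rewrite b0.
  by apply: le_trans; rewrite ler_ratio //; clear -lt p0 b0 leba; nia.
case/orP => [/ge|/hasP[[a b] abl] /= /andP[/ge lo hi]].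
  by move=> /(_ isT); rewrite /good_value le_eqVlt => /orP[/eqP <-|->] //; rewrite orbT.
have {}lo : (a%:R / b%:R <= cce w)%R.
  by apply: lo; move/lsub: abl; rewrite !inE => /or4P[] /eqP[-> ->].
have : cce w = (a%:R / b%:R)%R.
  apply/eqP; rewrite eq_le lo andbT leNgt; apply/negP => /(compl _ _ abl).
  exact/negP.
move/lsub: abl; rewrite !inE => /or4P[] /eqP[-> ->] ->; rewrite /good_value !inE ?eqxx ?orbT //.
Qed.

Lemma has_run_square w a b : 0 < size w -> 0 < b -> (a%:R / b%:R < cce w)%R ->
  has_run 0 (size w) (size w) a b (w ++ w).
Proof.
move=> w0 b0; have wn0 : w != [::] by rewrite -size_eq0 -lt0n.
have [s [L [p [lts [/andP[p0 lepL] leLw per] <-]]]] := circular_run_cce wn0.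
rewrite ltNge ler_ratio // -ltnNge => lt.
apply: (@has_run_complete _ _ _ _ _ w 0 s L p) => //.
- move=> k; rewrite size_cat add0n nth_cat /cyc => ltk.
  case: ltnP => lek; first by rewrite modn_small.
  by rewrite -{2}(subnK lek) modnDr modn_small //; clear -lek ltk; lia.
- by rewrite p0 (leq_trans lepL).
- by rewrite size_cat; clear -lts leLw; lia.
Qed.

(** * Windows around the seam *)

(** The radius 20 is the reach of a run in [seam_run_local]. *)
Definition seam_word (i n : nat) : word :=
  tm_factor (i + n - 20) 20 ++ tm_factor i 20.

Lemma nth_seam_word i n k : 20 <= n -> k < size (seam_word i n) ->
  nth false (seam_word i n) k = cyc (tm_factor i n) (n - 20 + k).
Proof.
move=> n20; rewrite size_cat !size_mkseq => ltk.
rewrite nth_cat size_mkseq cyc_tm_factor; last by clear -n20; lia.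
case: ltnP => lek.
  rewrite nth_mkseq // modn_small; last by clear -lek n20; lia.
  by congr thue_morse; clear -n20; lia.
rewrite nth_mkseq; last by clear -ltk; lia.
have -> : n - 20 + k = k - 20 + n by clear -lek n20; lia.
by rewrite modnDr modn_small //; clear -ltk n20; lia.
Qed.

(** As a/b >= 7/3, every run of exponent above a/b falls under [seam_run_local]. *)
Lemma has_run_seam i n a b : 20 <= n -> misaligned i n -> 0 < b -> 7 * b <= 3 * a ->
  (a%:R / b%:R < cce (tm_factor i n))%R -> has_run 0 40 17 a b (seam_word i n).
Proof.
move=> n20 mis b0 le7.
have w0 : tm_factor i n != [::] by rewrite -size_eq0 size_mkseq; clear -n20; lia.
have [s [L [p [lts run <-]]]] := circular_run_cce w0.
have [/andP[p0 lepL] leLn per] := run.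
rewrite ltNge ler_ratio // -ltnNge => lt; rewrite !size_mkseq in lts leLn.
have [] := seam_run_local mis lts run; first by clear -lt le7 b0; nia.
move=> p17 les leL.
have E : n - 20 + (s + 20 - n) = s by clear -les n20; lia.
apply: (@has_run_complete _ _ _ _ _ (tm_factor i n) (n - 20) (s + 20 - n) L p).
- by move=> k; apply: nth_seam_word.
- by [].
- by [].
- by rewrite p0.
- by clear -leL les lts; lia.
- by rewrite size_cat !size_mkseq; clear -leL les; lia.
- by rewrite E.
Qed.

Definition tm_block (m : nat) : word := iter m mu_word [:: false].

Lemma nth_tm_block m j b : j < 2 ^ m ->
  nth false [seq b (+) c | c <- tm_block m] j = b (+) thue_morse j.
Proof. by move=> ltj; rewrite (nth_map false) ?size_iter_mu // nth_iter_mu. Qed.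

(** Any 20 consecutive letters of the Thue-Morse word lie in two adjacent blocks mu^5(a) mu^5(b);
    [r] is the offset in the first. *)
Definition window (r : nat) (ab : bool * bool) : word :=
  take 20 (drop r ([seq ab.1 (+) c | c <- tm_block 5] ++
                   [seq ab.2 (+) c | c <- tm_block 5])).

Lemma tm_factor_window i :
  tm_factor i 20 = window (i %% 32) (thue_morse (i %/ 32), thue_morse (i %/ 32).+1).
Proof.
have ltr : i %% 32 < 32 by rewrite ltn_mod.
rewrite /window; set x := _ ++ _; have sx : size x = 64.
  by rewrite size_cat !size_map size_iter_mu.
apply: (@eq_from_nth _ false).
  by rewrite size_mkseq size_takel // size_drop sx; clear -ltr; lia.
rewrite size_mkseq => k ltk; rewrite nth_mkseq // nth_take // nth_drop /x nth_cat.
rewrite size_map size_iter_mu {1}(divn_eq i 32) mulnC -addnA.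
case: ltnP => H; first by rewrite nth_tm_block // (@tm_pow2_block 5).
have -> : 32 * (i %/ 32) + (i %% 32 + k) = 2 ^ 5 * (i %/ 32).+1 + (i %% 32 + k - 32).
  by clear -H; rewrite expnS; lia.
by rewrite nth_tm_block ?tm_pow2_block //; clear -ltr ltk H; lia.
Qed.

Definition windows (parity : bool) : seq word :=
  undup [seq window r ab | r <- [seq r <- iota 0 32 | odd r == parity],
           ab <- [:: (false, false); (false, true); (true, false); (true, true)]].

Lemma tm_factor_in_windows i : tm_factor i 20 \in windows (odd i).
Proof.
rewrite mem_undup tm_factor_window; apply: allpairs_f; last first.
  by case: thue_morse; case: thue_morse.
rewrite mem_filter mem_iota ltn_mod andbT; apply/eqP.
by rewrite [in RHS](divn_eq i 32) oddD oddM andbF.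
Qed.

(** * Finite checks by computation *)

(** For odd length the two windows start at positions of opposite parity. *)
Lemma classified_windows_odd :
  all (fun b => all (fun u => all (fun v =>
    classified 20 40 17 [:: (17, 7); (7, 3)] (u ++ v))
      (windows (~~ b))) (windows b)) [:: false; true].
Proof. by vm_compute. Qed.

(** For misaligned even length both windows start at odd positions and aa lies across the seam. *)
Lemma classified_windows_even :
  all (fun u => all (fun v => (nth false u 19 == nth false v 0) ==>
    classified 20 40 17 [:: (17, 7); (7, 3)] (u ++ v)) (windows true)) (windows true).
Proof. by vm_compute. Qed.

Lemma classified_short :
  all (fun n => all (fun u => let w := take n u in
    classified n n n [:: (17, 7); (7, 3); (2, 1); (1, 1)] (w ++ w))
      (windows false ++ windows true)) (iota 1 19).
Proof. by vm_compute. Qed.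

Lemma short_low_factor :
  all (fun n => has (fun i => let w := take n (drop i (tm_block 7)) in
    ~~ has_run 0 n n 5 2 (w ++ w)) (iota 0 64)) (iota 1 19).
Proof. by vm_compute. Qed.

Lemma medium_low_factor :
  all (fun n => odd n ==> has (fun i => ~~ has_run 0 40 17 5 2
    (take 20 (drop (i + n - 20) (tm_block 8)) ++ take 20 (drop i (tm_block 8))))
      (iota 0 100)) (iota 20 108).
Proof. by vm_compute. Qed.

(** The factor starts at offset [s] of a block mu^6(0) and ends just before offset [e] of a block
    mu^6(b). The bounds s <= 44 and 20 <= e keep each window inside its block, so only the length
    modulo 64 matters. *)
Lemma long_low_seam :
  all (fun r => odd r ==> has (fun s => has (fun b =>
    let e := (s + r) %% 64 in (20 <= e) && ~~ has_run 0 40 17 5 2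
      ([seq b (+) c | c <- take 20 (drop (e - 20) (tm_block 6))] ++
       take 20 (drop s (tm_block 6)))) [:: false; true]) (iota 0 45)) (iota 0 64).
Proof. by vm_compute. Qed.

(** * Factors as pieces of blocks mu^m(a) *)

Lemma tm_factor_take i n m : n <= m -> tm_factor i n = take n (tm_factor i m).
Proof. by move=> lenm; rewrite /tm_factor /mkseq -map_take take_iota (minn_idPl lenm). Qed.

Lemma tm_factor_block i n m : i + n <= 2 ^ m ->
  take n (drop i (tm_block m)) = tm_factor i n.
Proof.
move=> le; have sz : n <= size (drop i (tm_block m)).
  by rewrite size_drop size_iter_mu; clear -le; lia.
apply: (@eq_from_nth _ false); rewrite size_takel ?size_mkseq // => k ltk.
by rewrite nth_take // nth_drop nth_mkseq // nth_iter_mu //; clear -le ltk; lia.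
Qed.

Lemma tm_factor_shifted_block q i n m : i + n <= 2 ^ m ->
  tm_factor (2 ^ m * q + i) n =
  [seq thue_morse q (+) c | c <- take n (drop i (tm_block m))].
Proof.
move=> le; rewrite tm_factor_block // /tm_factor /mkseq -map_comp.
apply/eq_in_map => k; rewrite mem_iota => /andP[_ ltk] /=.
by rewrite -addnA tm_pow2_block //; clear -le ltk; lia.
Qed.

(** * Values of [cce] on all factors *)

Lemma good_value_seam i n : 20 <= n -> misaligned i n ->
  good_value (cce (tm_factor i n)).
Proof.
move=> n20 mis; apply: (@classified_good 20 40 17 [:: (17, 7); (7, 3)]
    (seam_word i n) _ (n - 20)).
- by move=> k; apply: nth_seam_word.
- by rewrite size_mkseq.
- by apply/allP.
- by move=> a b; rewrite !inE => /orP[] /eqP[-> ->] lt;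
    exact: (has_run_seam n20 mis _ _ lt).
have oE : odd (i + n - 20) = odd i (+) odd n by clear -n20; lia.
have uW := tm_factor_in_windows (i + n - 20); rewrite oE in uW.
have vW := tm_factor_in_windows i.
case: (boolP (odd n)) => on.
  rewrite on addbT in uW; rewrite -[odd i]negbK in vW.
  have b_in : ~~ odd i \in [:: false; true] by case: (odd i).
  by have /allP/(_ _ b_in)/allP/(_ _ uW)/allP/(_ _ vW) := classified_windows_odd.
move: mis; rewrite /misaligned (negPf on) => /andP[oi /eqP eqi].
rewrite (negPf on) oi in uW; rewrite oi in vW.
have /allP/(_ _ uW)/allP/(_ _ vW)/implyP := classified_windows_even.
apply; rewrite !nth_mkseq // addn0 eqi; apply/eqP.
by congr thue_morse; clear -n20; lia.
Qed.

Lemma good_value_cce i n : 0 < n -> good_value (cce (tm_factor i n)).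
Proof.
elim/ltn_ind: n i => n IH i n0; case: (ltnP n 20) => n20; last first.
  case: (boolP (misaligned i n)) => [|al]; first exact: good_value_seam.
  by rewrite cce_aligned // ?IH //; clear -n20; lia.
have sw : size (tm_factor i n) = n by rewrite size_mkseq.
have w0 : 0 < size (tm_factor i n) by rewrite sw.
apply: (@classified_good n n n [:: (17, 7); (7, 3); (2, 1); (1, 1)]
    (tm_factor i n ++ tm_factor i n) _ 0) => //; rewrite ?sw //.
- move=> k; rewrite size_cat sw add0n nth_cat /cyc sw => ltk.
  case: ltnP => lek; first by rewrite modn_small.
  by rewrite -{2}(subnK lek) modnDr modn_small //; clear -lek ltk; lia.
- move=> a b abl lt; rewrite -{1 2}sw; apply: has_run_square => //.
  by move: abl; rewrite !inE => /or4P[] /eqP[_ ->].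
have n_in : n \in iota 1 19 by rewrite mem_iota n0.
have u_in : tm_factor i 20 \in windows false ++ windows true.
  rewrite mem_cat; apply/orP; move: (tm_factor_in_windows i).
  by case: (odd i) => H; [right | left]; exact: H.
have := allP (allP classified_short n n_in) _ u_in; cbv beta zeta.
by rewrite -(tm_factor_take i (ltnW n20)).
Qed.

(** * Factors of every length with [cce] at most 5/2 *)

Lemma cce_seam_le i n : 20 <= n -> odd n -> ~~ has_run 0 40 17 5 2 (seam_word i n) ->
  (cce (tm_factor i n) <= 5 / 2)%R.
Proof.
move=> n20 on; rewrite leNgt; apply: contra => lt.
by apply: has_run_seam => //; rewrite /misaligned on.
Qed.

Lemma exists_low_cce n : 0 < n -> exists i, (cce (tm_factor i n) <= 5 / 2)%R.
Proof.
elim/ltn_ind: n => n IH n0; case: (ltnP n 20) => n20.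
  have n_in : n \in iota 1 19 by rewrite mem_iota n0.
  have /hasP[i] := allP short_low_factor n n_in; cbv beta zeta.
  rewrite mem_iota add0n => /andP[_ lti].
  rewrite tm_factor_block; last by clear -lti n20; lia.
  move=> H.
  have sw : size (tm_factor i n) = n by rewrite size_mkseq.
  exists i; rewrite leNgt; apply: contra H => lt; rewrite -{1 2}sw.
  by apply: has_run_square; rewrite ?sw.
case: (boolP (odd n)) => on; last first.
  have [||i lei] := IH n./2; [clear -n20; lia | clear -n20; lia |].
  (* An even start with even length is always aligned. *)
  exists i.*2; rewrite cce_aligned ?doubleK //; first by clear -n20; lia.
  by rewrite /misaligned (negPf on) odd_double.
case: (ltnP n 128) => n128.
  have n_in : n \in iota 20 108 by rewrite mem_iota n20.
  have /implyP/(_ on)/hasP[i] := allP medium_low_factor n n_in.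
  rewrite mem_iota add0n => /andP[_ lti].
  rewrite !tm_factor_block; [|clear -lti; lia|clear -lti n20 n128; lia] => H.
  by exists i; apply: cce_seam_le.
have n_in : n %% 64 \in iota 0 64 by rewrite mem_iota ltn_mod.
have on64 : odd (n %% 64) by move: on; rewrite {1}(divn_eq n 64) oddD oddM andbF.
have /implyP/(_ on64)/hasP[s s_in /hasP[b _]] := allP long_low_seam _ n_in.
have lts : s < 45 by move: s_in; rewrite mem_iota.
cbv zeta; set e := (s + n %% 64) %% 64 => /andP[e20 H].
have lte : e < 64 by rewrite ltn_mod.
(* The distance between the two blocks; [tm_letter_pair] then supplies blocks with letters 0 and [b]
   this far apart. *)
pose q := (n + s) %/ 64.
have Eq : n + s = q * 64 + e.
  by rewrite /q /e modnDmr [s + n]addnC -divn_eq.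
have q0 : 0 < q by clear -Eq lte n128; lia.
have [j [tj tjq]] := tm_letter_pair false b q0.
exists (2 ^ 6 * j + s); apply: cce_seam_le => //; rewrite /seam_word.
have -> : 2 ^ 6 * j + s + n - 20 = 2 ^ 6 * (j + q) + (e - 20).
  by rewrite -addnA [s + n]addnC Eq; clear -e20; rewrite (_ : 2 ^ 6 = 64) //; lia.
rewrite !tm_factor_shifted_block; [|rewrite (_ : 2 ^ 6 = 64) //; clear -lts lte; lia..].
by rewrite tj tjq [X in _ ++ X]map_id.
Qed.

Theorem theorem12 (n : nat) (hn : 1 <= n) :
  lcce n \in [:: 1; 2; 7 / 3; 17 / 7; 5 / 2]%R.
Proof.
have [[x [[i Ex] sx Ec]] lcce_min] := lcceP n.
have := good_value_cce i hn; rewrite sx in Ex; rewrite -[tm_factor i n]Ex Ec.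
case/orP => // lt; have [j low] := exists_low_cce hn.
have : (lcce n <= 5 / 2)%R.
  apply: le_trans low; apply: lcce_min; last by rewrite size_mkseq.
  by exists j; rewrite size_mkseq.
by rewrite leNgt lt.
Qed.
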